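(* Let $\lambda>0$, let $\nu$ be a non-negative measure on $(0,\infty)$ with $\int_0^\infty (s\wedge 1)\,\nu(ds)<\infty$, let $f(x)=\int_0^\infty (1-e^{-xs})\,\nu(ds)$, and let $N^f(t)$, $t\ge 0$, be the generalized Poisson counting process associated with $(\lambda,\nu)$ (defined in the context). For $k\ge 1$ let $$T_k^f=\inf\{t\ge 0: N^f(t)\ge k\}.$$ Then, for $s>0$, $$\frac{\Pr\{T_k^f\in ds\}}{ds}=-\frac{d}{ds}\sum_{l=0}^{k-1}\frac{(-\lambda)^l}{l!}\,\frac{d^l}{d\lambda^l}\,e^{-sf(\lambda)}.$$
   Context: The generalized Poisson counting process $N^f(t)$, $t\ge0$, associated with $(\lambda,\nu)$ is a non-negative integer-valued process with $N^f(0)=0$ and non-decreasing right-continuous paths, with independent and stationary increments, such that, writing $N^f[t,t+dt)$ for the increment over $[t,t+dt)$, as $dt\downarrow 0$, $$\Pr\{N^f[t,t+dt)=k\}=\begin{cases} dt\,\dfrac{\lambda^k}{k!}\displaystyle\int_0^\infty e^{-\lambda s}s^k\,\nu(ds)+o(dt), & k\ge 1,\\[2mm] 1-dt\displaystyle\int_0^\infty(1-e^{-\lambda s})\,\nu(ds)+o(dt), & k=0.\end{cases}$$ For each $t>0$, $N^f(t)$ has the same law as $N(H^f(t))$, where $N$ is a homogeneous Poisson process of rate $\lambda$ and $H^f$ is an independent subordinator with $\mathbb{E}e^{-\mu H^f(t)}=e^{-tf(\mu)}$. The left-hand side of the claimed formula denotes the probability density of $T_k^f$ on $(0,\infty)$.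 *)

(* Defs.v *)
From HB Require Import structures.
From mathcomp Require Import all_boot all_order all_algebra.
From mathcomp Require Import all_classical all_reals all_analysis.
From mathcomp Require Import measurable_realfun.
Set Implicit Arguments.
Unset Strict Implicit.
Unset Printing Implicit Defensive.
Import Order.TTheory GRing.Theory Num.Theory.
Import numFieldNormedType.Exports.
Local Open Scope classical_set_scope.
Local Open Scope ring_scope.

(* A measure on (0, oo) is represented by a measure [nu] on the Borel sets of
   [R] that is only ever integrated over `]0, +oo[, so that its values outside
   (0, oo) play no role. *)
Definition levy_integrable (R : realType)
    (nu : {measure set (measurableTypeR R) -> \bar R}) : Prop :=
  (\int[nu]_(s in `]0%R, +oo[) (Num.min s 1)%:E < +oo)%E.

Definition bernstein (R : realType)
    (nu : {measure set (measurableTypeR R) -> \bar R}) (x : R) : R :=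
  \int[nu]_(s in `]0, +oo[) (1 - expR (- (x * s))).

Definition jump_rate (R : realType) (lambda : R)
    (nu : {measure set (measurableTypeR R) -> \bar R}) (k : nat) : R :=
  lambda ^+ k / k`!%:R *
  \int[nu]_(s in `]0, +oo[) (expR (- (lambda * s)) * s ^+ k).

(* Taking some [A i] to be the whole space gives the product rule for every
   subfamily. *)
Definition mutually_independent (d d' : measure_display)
    (T : measurableType d) (U : measurableType d') (R : realType)
    (P : probability T R) (I : finType) (X : I -> T -> U) : Prop :=
  forall A : I -> set U, (forall i, measurable (A i)) ->
    P (\bigcap_(i in [set: I]) (X i @^-1` A i)) =
    (\prod_(i : I) P (X i @^-1` A i))%E.

(* The truncated subtraction of [nat] is the true one here when [0 <= s <= t],
   because the paths considered below are nondecreasing. *)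
Definition increment (T : Type) (R : realType) (N : R -> T -> nat)
    (s t : R) (w : T) : nat := (N t w - N s w)%N.

(* The time parameter ranges over [0, oo); values of [N] at negative times are
   unconstrained. *)
Record generalized_poisson_process (d : measure_display)
    (T : measurableType d) (R : realType) (P : probability T R)
    (lambda : R) (nu : {measure set (measurableTypeR R) -> \bar R})
    (N : R -> T -> nat) : Prop := {
  gpp_measurable : forall t, 0 <= t -> measurable_fun [set: T] (N t) ;
  gpp_start : forall w, N 0 w = 0%N ;
  gpp_nondecreasing : forall w s t, 0 <= s -> s <= t -> (N s w <= N t w)%N ;
  gpp_right_continuous : forall w t, 0 <= t ->
    ((N u w)%:R : R) @[u --> t^'+] --> ((N t w)%:R : R) ;
  gpp_independent_increments : forall (n : nat) (t : nat -> R),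
    0 <= t 0%N -> nondecreasing_seq t ->
    mutually_independent P (fun i : 'I_n => increment N (t i) (t i.+1)) ;
  gpp_stationary_increments : forall (s t h : R) (A : set nat),
    0 <= s -> 0 <= t -> 0 <= h -> measurable A ->
    P (increment N s (s + h) @^-1` A) = P (increment N t (t + h) @^-1` A) ;
  gpp_jump : forall (t : R) (k : nat), 0 <= t -> (0 < k)%N ->
    (fun h : R => fine (P (increment N t (t + h) @^-1` [set k]))) =
    (fun h : R => h * jump_rate lambda nu k) +o_ (0^'+) (fun h : R => h) ;
  gpp_no_jump : forall t : R, 0 <= t ->
    (fun h : R => fine (P (increment N t (t + h) @^-1` [set 0%N]))) =
    (fun h : R => 1 - h * \int[nu]_(s in `]0, +oo[)
                             (1 - expR (- (lambda * s))))
      +o_ (0^'+) (fun h : R => h)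
}.

(* Extended-real valued: the infimum is +oo when the level is never reached. *)
Definition passage_time (T : Type) (R : realType) (N : R -> T -> nat)
    (k : nat) (w : T) : \bar R :=
  ereal_inf [set t%:E | t in [set t : R | 0 <= t /\ (k <= N t w)%N]].

(* [X] may charge values outside [D], in particular +oo. *)
Definition has_density_on (d : measure_display) (T : measurableType d)
    (R : realType) (P : probability T R) (X : T -> \bar R) (D : set R)
    (g : R -> R) : Prop :=
  [/\ measurable_fun [set: T] X,
      measurable_fun (D : set (measurableTypeR R)) g,
      forall s, D s -> 0 <= g s &
      forall A : set (measurableTypeR R), measurable A -> A `<=` D ->
        P (X @^-1` (EFin @` A)) = (\int[lebesgue_measure]_(s in A) (g s)%:E)%E].

Definition exp_bernstein (R : realType)
    (nu : {measure set (measurableTypeR R) -> \bar R}) (s x : R) : R :=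
  expR (- (s * bernstein nu x)).

Definition derivative_sum (R : realType) (lambda : R)
    (nu : {measure set (measurableTypeR R) -> \bar R}) (k : nat) (s : R) : R :=
  \sum_(l < k) (- lambda) ^+ l / l`!%:R * derive1n l (exp_bernstein nu s) lambda.

(* Main.v *)
Require Import Defs.
From HB Require Import structures.
From mathcomp Require Import all_boot all_order all_algebra.
From mathcomp Require Import all_classical all_reals all_analysis.
From mathcomp Require Import measurable_realfun.
From mathcomp Require Import ring lra.
Set Implicit Arguments.
Unset Strict Implicit.
Unset Printing Implicit Defensive.
Import Order.TTheory GRing.Theory Num.Theory.
Import numFieldNormedType.Exports.
Local Open Scope classical_set_scope.
Local Open Scope ring_scope.

(** The passage time satisfies [T_k <= t] exactly when [N t >= k], because the
    paths are nondecreasing, right-continuous and integer-valued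
    ([passage_time_le]). Hence [P (T_k <= t) = 1 - \sum_(l < k) P (N t = l)],
    and everything rests on the law of [N t]:
      [P (N t = l) = (- lambda) ^+ l / l`! * d^l / d lambda^l e^(- t f(lambda))],
    which is [counting_pmfE]. It holds because both sides, as sequences in [l]
    depending on [t], solve the same triangular system of linear differential
    equations [u_l' = \sum_(j <= l) u_j a_(l - j)] with [u_l 0 = (l == 0)], and
    such a system has only one solution ([conv_ode_unique]).

    On the probabilistic side, independence and stationarity of the increments
    make the laws of [N t] a semigroup for the convolution of sequences, and the
    infinitesimal description of the jumps is its generator [a]: here
    [a_0 = - f(lambda)] and [a_l] is the rate of jumps of size [l]
    ([semigroup_is_derive]). The one-sided information at [0] gives two-sided
    derivatives at [t > 0] because a left difference quotient at [t] is an
    increment started at [t - h].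

    On the analytic side, [f] can be differentiated under the integral sign
    infinitely often on [(0, oo)], and
    [a_l = - (- lambda) ^+ l f^(l)(lambda) / l`!].
    With normalised Taylor coefficients [c_l = f^(l) / l`!], and [d_l] those of
    [e^(- t f)], the chain rule reads [d' = - t f' d] in the sense of
    convolutions, which gives the smoothness in [x] together with a recursion
    ([exp_taylor_coef_rec]); commutativity and associativity of the convolution
    then turn the recursion into the equation in time
    ([is_derive_time_exp_taylor_coef]).

    Finally the distribution function of [T_k] is [1 - S] on [[0, oo)], where [S]
    is the sum of the first [k] masses. It is continuously differentiable, so that
    [- S'] is a density on [(0, oo)] by the fundamental theorem of calculus and
    uniqueness of measures on a generating family of intervals
    ([has_density_of_cdf]). *)

(** * Derivatives of the Bernstein function *)

(** The [m]-th derivative in [x] of [1 - expR (- (x * s))]. *)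
Definition bernstein_kernel (R : realType) (m : nat) (x s : R) : R :=
  if m is n.+1 then (-1) ^+ n * (s ^+ m * expR (- (x * s)))
  else 1 - expR (- (x * s)).

Definition bernstein_deriv (R : realType)
    (nu : {measure set (measurableTypeR R) -> \bar R}) (m : nat) (x : R) : R :=
  \int[nu]_(s in `]0, +oo[) bernstein_kernel m x s.

Lemma exprn_le_fact_expR (R : realType) (n : nat) (y : R) :
  0 <= y -> y ^+ n <= n`!%:R * expR y.
Proof.
move=> y0; case: n => [|n].
  by rewrite expr0 fact0 mul1r -expR0 ler_expR.
have := expR_ge1Dxn n y0; rewrite -ler_pdivrMl ?ltr0n ?fact_gt0//.
by rewrite mulrC; apply: le_trans; rewrite lerDr.
Qed.

Lemma exprn_expRN_le (R : realType) (n : nat) (a x s : R) :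
  0 < a -> a <= x -> 0 <= s -> s ^+ n * expR (- (x * s)) <= n`!%:R / a ^+ n.
Proof.
move=> a0 ax s0; rewrite expRN ler_pdivrMr ?expR_gt0// mulrAC.
rewrite ler_pdivlMr ?exprn_gt0// -exprMn mulrC.
rewrite mulrC (le_trans (exprn_le_fact_expR n _)) ?mulr_ge0 ?(ltW a0)//.
by rewrite ler_wpM2l// ler_expR mulrC ler_wpM2r.
Qed.

(** The function [s ^+ n * expR (- (a * s))] is bounded on [(0, oo)] for every
    [n], which controls the kernel by a constant for [s > 1] and, after setting
    one factor [s] aside, by a multiple of [s] for [s <= 1]. The bound does not
    depend on [x >= a], as domination requires. *)
Lemma bernstein_kernelS_le (R : realType) (n : nat) (a x s : R) :
  0 < a -> a <= x -> 0 < s ->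
  `|bernstein_kernel n.+1 x s| <=
    (n`!%:R / a ^+ n + n.+1`!%:R / a ^+ n.+1) * Num.min s 1.
Proof.
move=> a0 ax s0; rewrite /= normrM normrX normrN1 expr1n mul1r ger0_norm; last first.
  by rewrite mulr_ge0 ?expR_ge0 ?exprn_ge0 ?ltW.
have c0 m : 0 <= (m`!%:R : R) / a ^+ m by rewrite divr_ge0 ?exprn_ge0 ?ltW.
case: (leP s 1) => s1.
  rewrite exprSr mulrAC ler_wpM2r ?(ltW s0)//.
  rewrite (le_trans (exprn_expRN_le n a0 ax (ltW s0)))//.
  by rewrite lerDl.
rewrite mulr1 (le_trans (exprn_expRN_le n.+1 a0 ax (ltW s0)))//.
by rewrite lerDr.
Qed.

Lemma bernstein_kernel0_le (R : realType) (x s : R) :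
  0 < x -> 0 < s -> `|bernstein_kernel 0 x s| <= (1 + x) * Num.min s 1.
Proof.
move=> x0 s0; have xs0 : 0 < x * s by rewrite mulr_gt0.
have e1 : expR (- (x * s)) <= 1 by rewrite -expR0 ler_expR oppr_le0 ltW.
rewrite /= ger0_norm ?subr_ge0//.
have e2 := expR_ge1Dx (- (x * s)).
have e3 := expR_ge0 (- (x * s)).
case: (leP s 1) => s1; [nra|lra].
Qed.

Lemma is_derive_bernstein_kernel (R : realType) (m : nat) (x s : R) :
  is_derive x 1 (fun y => bernstein_kernel m y s) (bernstein_kernel m.+1 x s).
Proof.
have de : is_derive x 1 (fun y : R => expR (- (y * s))) (- s * expR (- (x * s))).
  have dl : is_derive x 1 (fun y : R => - (y * s)) (- s).
    have -> : (fun y : R => - (y * s)) = (- s) \*: id.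
      by apply/funext => y /=; rewrite mulrC -mulNr.
    by apply: is_derive_eq; rewrite /GRing.scale/= mulr1.
  have := @is_derive1_comp _ (@expR R) _ _ _ _ (is_derive_expR _) dl.
  by rewrite mulrC.
case: m => [|n] /=.
  have -> : (fun y => 1 - expR (- (y * s))) = cst 1 - (fun y => expR (- (y * s))) by [].
  apply: is_derive_eq.
  by rewrite sub0r expr0 mul1r expr1 mulNr opprK.
have -> : (fun y : R => (-1) ^+ n * (s ^+ n.+1 * expR (- (y * s)))) =
    ((-1) ^+ n * s ^+ n.+1) \*: (fun y : R => expR (- (y * s))).
  by apply/funext => y /=; rewrite /GRing.scale/= mulrA.
apply: is_derive_eq; rewrite /GRing.scale/= [(-1) ^+ n.+1]exprS.
by rewrite [s ^+ n.+2]exprS mulN1r !mulNr mulrN !mulrA [_ * s ^+ _ * s]mulrAC.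
Qed.

Lemma measurable_bernstein_kernel (R : realType) (m : nat) (x : R) :
  measurable_fun [set: measurableTypeR R] (bernstein_kernel m x).
Proof.
have ml : measurable_fun [set: R] (fun s : R => - (x * s)).
  have -> : (fun s : R => - (x * s)) = *%R (- x).
    by apply/funext => s; rewrite mulNr.
  exact: mulrl_measurable.
have me := measurableT_comp (@measurable_expR R) ml.
case: m => [|n] /=.
  by apply: (measurable_funB _ me); exact: measurable_cst.
apply: measurable_funM; first exact: measurable_cst.
by apply: (measurable_funM _ me); exact: exprn_measurable.
Qed.

Lemma integrable_min (R : realType)
    (nu : {measure set (measurableTypeR R) -> \bar R}) (C : R) :
  levy_integrable nu ->
  nu.-integrable `]0, +oo[ (EFin \o (fun s : measurableTypeR R => C * Num.min s 1)).
Proof.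
move=> hnu.
have -> : EFin \o (fun s : measurableTypeR R => C * Num.min s 1) =
  (fun s : measurableTypeR R => C%:E * (Num.min s 1)%:E)%E by [].
apply: integrableZl => //; apply/integrableP; split.
  by apply/measurable_EFinP; apply: measurable_funTS; exact: measurable_minr.
rewrite (le_lt_trans _ hnu)// le_eqVlt; apply/orP; left; apply/eqP.
apply: eq_integral => s; rewrite inE/= in_itv/= andbT => s0.
by rewrite /= ger0_norm// le_min ltW//=.
Qed.

Lemma integrable_bernstein_kernel (R : realType)
    (nu : {measure set (measurableTypeR R) -> \bar R}) (m : nat) (x : R) :
  levy_integrable nu -> 0 < x ->
  nu.-integrable `]0, +oo[ (EFin \o bernstein_kernel m x).
Proof.
move=> hnu x0.
pose C := if m is n.+1 then n`!%:R / x ^+ n + n.+1`!%:R / x ^+ n.+1 else 1 + x.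
apply: (le_integrable _ _ _ (integrable_min C hnu)) => //.
  apply/measurable_EFinP; apply: measurable_funTS.
  exact: measurable_bernstein_kernel.
move=> s /=; rewrite in_itv/= andbT => s0; rewrite lee_fin.
apply: le_trans (ler_norm _); rewrite /C.
case: m {C} => [|n]; first exact: bernstein_kernel0_le.
exact: bernstein_kernelS_le.
Qed.

(** Differentiation under the integral sign; the derivative of the integrand is
    dominated near [x] by a multiple of [Num.min s 1] because [x / 2] keeps the
    parameter away from [0]. *)
Lemma is_derive_bernstein_deriv (R : realType)
    (nu : {measure set (measurableTypeR R) -> \bar R}) (m : nat) (x : R) :
  levy_integrable nu -> 0 < x ->
  is_derive x 1 (bernstein_deriv nu m) (bernstein_deriv nu m.+1 x).
Proof.
move=> hnu x0; set a := x / 2; have a0 : 0 < a by rewrite divr_gt0.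
have xI : `]a, (x + 1)[%classic x.
  by rewrite /= in_itv/= /a; apply/andP; split; lra.
pose C := m`!%:R / a ^+ m + m.+1`!%:R / a ^+ m.+1 : R.
have intf y : `]a, (x + 1)[%classic y ->
    nu.-integrable `]0, +oo[ (EFin \o bernstein_kernel m y).
  rewrite /= in_itv/= => /andP[ay _].
  by apply: integrable_bernstein_kernel => //; exact: lt_trans ay.
have dE y s : partial1of2 (bernstein_kernel m) y s = bernstein_kernel m.+1 y s.
  by rewrite partial1of2E; have /@derive_val := is_derive_bernstein_kernel m y s.
pose G (s : measurableTypeR R) := `|C * Num.min s 1|.
have G0 s : 0 <= G s by exact: normr_ge0.
have intG : nu.-integrable `]0, +oo[ (EFin \o G).
  have := integrable_abse (integrable_min C hnu).
  by [].
have GU y s : `]a, (x + 1)[%classic y -> `]0, +oo[%classic s ->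
    `|partial1of2 (bernstein_kernel m) y s| <= G s.
  rewrite /= !in_itv/= andbT => /andP[ay _] s0; rewrite dE.
  by apply: le_trans (ler_norm _); apply: bernstein_kernelS_le => //; exact: ltW.
have dd y s : `]a, (x + 1)[%classic y -> `]0, +oo[%classic s ->
    derivable (bernstein_kernel m ^~ s) y 1.
  by move=> _ _; have /@ex_derive := is_derive_bernstein_kernel m y s.
have mI : measurable (`]0, +oo[ : set (measurableTypeR R)) by [].
apply: DeriveDef.
  exact: (derivable_under_integral mI xI intf dd G0 intG GU).
rewrite -derive1E.
rewrite (differentiation_under_integral mI xI intf dd G0 intG GU).
by apply: eq_Rintegral => s _; rewrite dE.
Qed.

(** * Convolution of sequences *)

Definition conv (V : pzSemiRingType) (a b : nat -> V) (k : nat) : V :=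
  \sum_(j < k.+1) a j * b (k - j)%N.

Lemma conv_coef (V : comNzRingType) (n : nat) (a b : nat -> V) (k : nat) :
  (k <= n)%N -> conv a b k = (\poly_(i < n.+1) a i * \poly_(i < n.+1) b i)`_k.
Proof.
move=> kn; rewrite coefM; apply: eq_bigr => j _; rewrite !coef_poly.
rewrite ltnS (leq_trans _ kn) ?leq_ord// ltnS (leq_trans _ kn)//.
exact: leq_subr.
Qed.

(** Up to order [k] the convolution is the product of truncated power series, so
    the identity is [mulrAC] for polynomials. *)
Lemma convAC (V : comNzRingType) (a b c : nat -> V) (k : nat) :
  conv (conv a b) c k = conv (conv a c) b k.
Proof.
have E (u v : nat -> V) : conv (conv a u) v k =
    (\poly_(i < k.+1) a i * \poly_(i < k.+1) u i * \poly_(i < k.+1) v i)`_k.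
  rewrite coefM; apply: eq_bigr => j _; rewrite coef_poly ltnS leq_subr.
  by rewrite (@conv_coef _ k)// -ltnS.
by rewrite !E mulrAC.
Qed.

(** Leibniz rule for the formal derivative of power series, which maps [a] to
    [j.+1%:R * a j.+1]. *)
Lemma conv_deriv (V : comNzRingType) (a b : nat -> V) (k : nat) :
  conv (fun j => j.+1%:R * a j.+1) b k + conv a (fun j => j.+1%:R * b j.+1) k =
  k.+1%:R * conv a b k.+1.
Proof.
rewrite mulr_sumr.
under [RHS]eq_bigr => j _.
  rewrite -{1}(@subnKC j k.+1) ?leq_ord// natrD mulrDl; over.
rewrite big_split/= big_ord_recl/= mul0r add0r; congr (_ + _).
  by apply: eq_bigr => j _; rewrite /bump/= add1n subSS mulrA.
rewrite big_ord_recr/= subnn mul0r addr0; apply: eq_bigr => j _.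
by rewrite subSn ?leq_ord// mulrCA.
Qed.

Lemma is_derive_conv (R : realType) (a b : nat -> R -> R) (a' b' : nat -> R)
    (x : R) (k : nat) :
  (forall j, (j <= k)%N -> is_derive x 1 (a j) (a' j)) ->
  (forall j, (j <= k)%N -> is_derive x 1 (b j) (b' j)) ->
  is_derive x 1 (fun y => conv (a ^~ y) (b ^~ y) k)
    (conv a' (b ^~ x) k + conv (a ^~ x) b' k).
Proof.
move=> da db; rewrite /conv -big_split/=.
have -> : (fun y => \sum_(j < k.+1) a j y * b (k - j)%N y) =
    \sum_(j < k.+1) (a j * b (k - j)%N).
  by apply/funext => y; rewrite fct_sumE.
apply: is_derive_sum => j.
have daj := da j (leq_ord j); have dbj := db _ (leq_subr j k).
by apply: is_derive_eq; rewrite /GRing.scale/= addrC [b _ _ * _]mulrC.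
Qed.

(** * Taylor coefficients of exp (- t f)

    [F m] plays the role of the [m]-th derivative of [f = F 0] on [(0, oo)]. *)
Section exp_derivatives.
Variables (R : realType) (F : nat -> R -> R).
Hypothesis dF : forall m (x : R), 0 < x -> is_derive x 1 (F m) (F m.+1 x).

Let g (t x : R) : R := expR (- (t * F 0%N x)).

Definition taylor_coef (m : nat) (x : R) : R := F m x / m`!%:R.

Definition exp_taylor_coef (t : R) (m : nat) (x : R) : R :=
  derive1n m (g t) x / m`!%:R.

Let factS_neq0 m : m`!%:R != 0 :> R.
Proof. by rewrite pnatr_eq0 -lt0n fact_gt0. Qed.

Let taylorS (a : nat -> R) (m : nat) :
  m.+1%:R * (a m.+1 / m.+1`!%:R) = a m.+1 / m`!%:R.
Proof.
rewrite mulrCA; congr (_ * _).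
by rewrite factS natrM invfM mulrA divff ?mul1r// pnatr_eq0.
Qed.

Lemma is_derive_taylor_coef (m : nat) (x : R) : 0 < x ->
  is_derive x 1 (taylor_coef m) (m.+1%:R * taylor_coef m.+1 x).
Proof.
move=> x0; have dFx := dF m x0; rewrite (taylorS (F ^~ x)).
have -> : taylor_coef m = m`!%:R^-1 \*: F m.
  by apply/funext => y; rewrite /taylor_coef/= mulrC.
by apply: is_derive_eq; rewrite /GRing.scale/= mulrC.
Qed.

Lemma is_derive_exp_taylor_coef (t : R) (m : nat) (x : R) :
  derivable (derive1n m (g t)) x 1 ->
  is_derive x 1 (exp_taylor_coef t m) (m.+1%:R * exp_taylor_coef t m.+1 x).
Proof.
move=> /derivableP dg; rewrite (taylorS (fun j => derive1n j (g t) x)).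
have -> : exp_taylor_coef t m = m`!%:R^-1 \*: derive1n m (g t).
  by apply/funext => y; rewrite /exp_taylor_coef/= mulrC.
by apply: is_derive_eq; rewrite /GRing.scale/= mulrC -derive1E -derive1nS.
Qed.

(** The recursion is the coefficient of order [k] in the formal identity
    [d' = - t f' d] for [d = e^(- t f)]. It has to be proved together with
    differentiability: the right-hand side at order [k] only involves derivatives
    of [e^(- t f)] of order at most [k], so it can be differentiated once more,
    and the Leibniz rule yields the recursion at order [k.+1]. *)
Lemma exp_taylor_coef_rec (t x : R) (k : nat) : 0 < x ->
  derivable (derive1n k (g t)) x 1 /\
  k.+1%:R * exp_taylor_coef t k.+1 x =
  - t * conv (exp_taylor_coef t ^~ x)
             (fun j => j.+1%:R * taylor_coef j.+1 x) k.
Proof.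
elim/ltn_ind: k x => -[|k] IH x x0.
  have dg : is_derive x 1 (g t) (- t * (g t x * F 1%N x)).
    have dF0 := dF 0 x0.
    have dl : is_derive x 1 (fun y => - (t * F 0%N y)) (- t * F 1%N x).
      have -> : (fun y => - (t * F 0%N y)) = - t \*: F 0%N.
        by apply/funext => y /=; rewrite -mulNr.
      exact: is_derive_eq.
    have := @is_derive1_comp _ (@expR R) _ _ _ _ (is_derive_expR _) dl.
    by rewrite /g mulrCA.
  split; first exact: ex_derive.
  rewrite /conv big_ord1 mul1r subnn mul1r /exp_taylor_coef /taylor_coef.
  by rewrite !fact0 /= !divr1 derive1E derive_val.
have dd j : (j <= k)%N -> is_derive x 1 (exp_taylor_coef t j)
    (j.+1%:R * exp_taylor_coef t j.+1 x).
  by move=> jk; apply: is_derive_exp_taylor_coef; case: (IH j _ x).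
have de j : (j <= k)%N -> is_derive x 1 (fun y => j.+1%:R * taylor_coef j.+1 y)
    (j.+1%:R * (j.+2%:R * taylor_coef j.+2 x)).
  move=> _; have dc := is_derive_taylor_coef j.+1 x0.
  have -> : (fun y => j.+1%:R * taylor_coef j.+1 y) = j.+1%:R \*: taylor_coef j.+1.
    by [].
  exact: is_derive_eq.
have dconv := is_derive_conv dd de.
rewrite (conv_deriv (exp_taylor_coef t ^~ x)
          (fun j => j.+1%:R * taylor_coef j.+1 x)) in dconv.
set C := (fun y => conv _ _ _) in dconv.
have dG : is_derive x 1 (derive1n k.+1 (g t))
    (k`!%:R * - t * (k.+1%:R * conv (exp_taylor_coef t ^~ x)
             (fun j => j.+1%:R * taylor_coef j.+1 x) k.+1)).
  apply: (@near_eq_is_derive _ _ _ ((k`!%:R * - t) \*: C)).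
    near=> y; have y0 : 0 < y by near: y; exact: lt_nbhsr.
    have [_ dy] := IH k (ltnSn k) y y0.
    rewrite -[LHS]/(_ * _ * C y) -[LHS]mulrA -dy.
    by rewrite mulrA -natrM mulnC -factS /exp_taylor_coef mulrC divfK.
split; first exact: ex_derive.
have /@derive_val := dG; rewrite -derive1E -derive1nS.
set K := conv _ _ _ => dE.
rewrite {1}/exp_taylor_coef dE !factS !natrM.
have := factS_neq0 k; have : k.+1%:R != 0 :> R by rewrite pnatr_eq0.
have : k.+2%:R != 0 :> R by rewrite pnatr_eq0.
move: k.+2%:R k.+1%:R k`!%:R => a b c a0 b0 c0.
by field; rewrite a0 b0 c0.
Unshelve. all: by end_near. Qed.
Lemma derivable_exp_taylor (t x : R) (k : nat) : 0 < x ->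
  derivable (derive1n k (g t)) x 1.
Proof. by move=> x0; case: (exp_taylor_coef_rec t k x0). Qed.

(** This is the time derivative [- f e^(- t f)], read on Taylor coefficients in
    [x]. Exchanging the derivatives in [t] and [x] is avoided: by induction
    through the recursion [d' = - t f' d], the claim at order [k.+1] reduces to
    [(d f) f' = (d f') f] for convolutions. *)
Lemma is_derive_time_exp_taylor_coef (t x : R) (k : nat) : 0 < x ->
  is_derive t 1 (fun s => exp_taylor_coef s k x)
    (- conv (exp_taylor_coef t ^~ x) (taylor_coef ^~ x) k).
Proof.
move=> x0; elim/ltn_ind: k => -[|k] IH.
  have -> : (fun s => exp_taylor_coef s 0 x) = (fun s => expR (- (s * F 0%N x))).
    by apply/funext => s; rewrite /exp_taylor_coef fact0 divr1.
  have dl : is_derive t 1 (fun s => - (s * F 0%N x)) (- F 0%N x).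
    have -> : (fun s => - (s * F 0%N x)) = - F 0%N x \*: id.
      by apply/funext => s /=; rewrite mulrC -mulNr.
    by apply: is_derive_eq; rewrite /GRing.scale/= mulr1.
  have := @is_derive1_comp _ (@expR R) _ _ _ _ (is_derive_expR _) dl.
  rewrite mulrN; congr (is_derive _ _ _ (- _)).
  by rewrite /conv big_ord1 subnn /exp_taylor_coef /taylor_coef fact0 !divr1.
pose d := exp_taylor_coef t ^~ x; pose c := taylor_coef ^~ x.
pose e j := j.+1%:R * c j.+1.
have dE s : exp_taylor_coef s k.+1 x =
    k.+1%:R^-1 * (- s * conv (exp_taylor_coef s ^~ x) e k).
  by case: (exp_taylor_coef_rec s k x0) => _ <-; rewrite mulKf ?pnatr_eq0.
have dconv : is_derive t 1 (fun s => conv (exp_taylor_coef s ^~ x) e k)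
    (- conv (conv d c) e k).
  have := @is_derive_conv R (fun j s => exp_taylor_coef s j x) (fun j _ => e j)
    (fun j => - conv d c j) (fun=> 0) t k.
  move=> /(_ _ _)/=; rewrite /conv -!sumrN.
  rewrite [X in _ + X]big1 ?addr0; last by move=> j _; rewrite mulr0.
  under [X in _ -> is_derive _ _ _ X]eq_bigr do rewrite -mulNr.
  by apply=> j jk; exact: IH.
have dm : is_derive t 1 (fun s : R => - s) (-1) by exact: is_deriveNid.
have := is_deriveZ k.+1%:R^-1 (is_deriveM dm dconv).
rewrite (_ : _ \*: _ = (fun s => exp_taylor_coef s k.+1 x)); last first.
  by apply/funext => s; rewrite dE.
congr (is_derive _ _ _ _).
apply: (mulfI (_ : k.+1%:R != 0)); first by rewrite pnatr_eq0.
rewrite /GRing.scale/= mulVKf ?pnatr_eq0//.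
rewrite [RHS]mulrN -conv_deriv -/d -/c.
have -> : conv (fun j => j.+1%:R * d j.+1) c k = - t * conv (conv d e) c k.
  rewrite [LHS]/conv [conv (conv d e) c k]/conv mulr_sumr.
  apply: eq_bigr => j _ /=; rewrite /d.
  by have [_ ->] := exp_taylor_coef_rec t j x0; rewrite -mulrA.
rewrite (convAC d c e); ring.
Qed.

End exp_derivatives.

(** * Convolution semigroups on sequences *)

Lemma conv_unitr (V : pzSemiRingType) (b : nat -> V) (k : nat) :
  conv b (fun m => (m == 0%N)%:R) k = b k.
Proof.
rewrite /conv big_ord_recr/= subnn mulr1 big1 ?add0r// => j _.
by rewrite gtn_eqF ?mulr0// subn_gt0.
Qed.

Lemma cvg_conv (R : realType) (I : Type) (F : set_system I) {FF : Filter F}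
    (a b : I -> nat -> R) (la lb : nat -> R) (k : nat) :
  (forall j, (j <= k)%N -> a i j @[i --> F] --> la j) ->
  (forall j, (j <= k)%N -> b i j @[i --> F] --> lb j) ->
  conv (a i) (b i) k @[i --> F] --> conv la lb k.
Proof.
move=> ha hb; apply: (cvg_big (@add_continuous _)) => j _; apply: cvgM.
  by apply: ha; exact: leq_ord.
by apply: hb; exact: leq_subr.
Qed.

(** [p k t] stands for the mass at [k] at time [t], and [a] for the generator of
    the semigroup. *)
Section convolution_semigroup.
Variables (R : realType) (p : nat -> R -> R) (a : nat -> R).
Hypothesis p_ge0 : forall k t, 0 <= t -> 0 <= p k t.
Hypothesis p_le1 : forall k t, 0 <= t -> p k t <= 1.
Hypothesis p_semigroup : forall k s t, 0 <= s -> 0 <= t ->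
  p k (s + t) = conv (p ^~ s) (p ^~ t) k.
Hypothesis p_generator : forall k,
  h^-1 * (p k h - (k == 0%N)%:R) @[h --> 0^'+] --> a k.

Lemma semigroup_cvg0 (k : nat) : p k h @[h --> 0^'+] --> ((k == 0%N)%:R : R).
Proof.
have h0 : h @[h --> (0 : R)^'+] --> (0 : R).
  by apply: cvg_at_right_filter; exact: cvg_id.
have := cvgD (cvgM h0 (p_generator (k:=k))) (cvg_cst ((k == 0%N)%:R : R)).
rewrite mul0r add0r => /(_ _ _ _) H; apply: cvg_trans H; apply: near_eq_cvg; near=> h.
rewrite !fctE/= mulVKf ?subrK//.
Unshelve. all: by end_near. Qed.

Lemma semigroup_diff (k : nat) (s h : R) : 0 <= s -> 0 <= h ->
  p k (s + h) - p k s = conv (p ^~ s) (fun m => p m h - (m == 0%N)%:R) k.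
Proof.
move=> s0 h0; rewrite p_semigroup// -[p k s](conv_unitr (p ^~ s)).
rewrite /conv -sumrB; by apply: eq_bigr => j _; rewrite mulrBr.
Qed.

(** The increment from [t - h] to [t] is [p (t - h)], which is bounded by 1,
    convolved with [p h - delta_0], which tends to 0. *)
Lemma semigroup_left_continuous (k : nat) (t : R) : 0 < t ->
  p k (t - h) @[h --> 0^'+] --> p k t.
Proof.
move=> t0; apply/subr_cvg0.
pose M h := \sum_(j < k.+1) `|p (k - j)%N h - ((k - j)%N == 0%N)%:R|.
have M0 : M h @[h --> 0^'+] --> (0 : R).
  suff: M h @[h --> 0^'+] --> \sum_(j < k.+1) (0 : R) by rewrite big1_eq.
  apply: (cvg_big (@add_continuous _)) => j _; rewrite -[X in _ --> X](@normr0 _ R).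
  by apply: cvg_norm; apply/subr_cvg0; exact: semigroup_cvg0.
apply: norm_cvg0.
apply: (@squeeze_cvgr _ _ _ _ (cst 0) M) => //; last exact: cvg_cst.
near=> h; rewrite normr_ge0/=.
have h0 : 0 <= h by near: h; exact: nbhs_right_ge.
have th : 0 <= t - h by rewrite subr_ge0; near: h; exact: nbhs_right_le.
rewrite distrC -{1}(subrK h t) semigroup_diff// (le_trans (ler_norm_sum _ _ _))//.
apply: ler_sum => j _; rewrite normrM ler_piMl//.
by rewrite ger0_norm ?p_le1 ?p_ge0.
Unshelve. all: by end_near. Qed.

(** To the right of [t] the difference quotient is [p t] convolved with the
    quotient at [0]; to the left it is [p (t - h)] convolved with the same
    quotient, and left continuity gives the same limit. *)
Lemma semigroup_is_derive (k : nat) (t : R) : 0 < t ->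
  is_derive t 1 (p k) (conv (p ^~ t) a k).
Proof.
move=> t0.
have quot : h^-1 *: ((p k \o shift t) h - p k t) @[h --> 0^'] -->
    conv (p ^~ t) a k.
  apply: (@cvg_at_right_left_dnbhs _ R^o).
    apply: cvg_trans (cvg_conv (fun j _ => cvg_cst (p j t))
      (fun j _ => @p_generator j)).
    apply: near_eq_cvg; near=> h.
    have h0 : 0 <= h by near: h; exact: nbhs_right_ge.
    rewrite /= [h + t]addrC semigroup_diff ?(ltW t0)// /GRing.scale/= mulr_sumr.
    by apply: eq_bigr => j _; rewrite mulrCA.
  apply/cvg_at_leftNP; rewrite oppr0.
  apply: cvg_trans (cvg_conv (fun j _ => @semigroup_left_continuous j t t0)
      (fun j _ => @p_generator j)).
  apply: near_eq_cvg; near=> h.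
  have h0 : 0 <= h by near: h; exact: nbhs_right_ge.
  have th : 0 <= t - h by rewrite subr_ge0; near: h; exact: nbhs_right_le.
  rewrite /= [- h + t]addrC invrN -[p k t in RHS](congr1 (p k) (subrK h t)).
  rewrite /GRing.scale/= mulNr -mulrN opprB semigroup_diff// mulr_sumr.
  by apply: eq_bigr => j _; rewrite mulrCA.
have quot' : h^-1 *: ((p k \o shift t) (h *: 1) - p k t) @[h --> 0^'] -->
    conv (p ^~ t) a k.
  by under eq_fun do rewrite [_ *: 1]mulr1.
by apply: DeriveDef; [apply/cvg_ex; exists (conv (p ^~ t) a k)|exact: cvg_lim].
Unshelve. all: by end_near. Qed.

End convolution_semigroup.

Lemma is_derive_continuous (R : realType) (f : R -> R) (x a : R) :
  is_derive x 1 f a -> {for x, continuous f}.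
Proof. by move=> [df _]; exact/differentiable_continuous/derivable1_diffP. Qed.

(** [expR (- (c * t)) * w t] has zero derivative on [(0, oo)]; the hypothesis at
    [0] is only one-sided because the functions of interest are meaningful for
    nonnegative times only. *)
Lemma linear_ode_unique (R : realType) (w : R -> R) (c : R) :
  w t @[t --> (0 : R)^'+] --> w 0 ->
  (forall t : R, 0 < t -> is_derive t 1 w (c * w t)) ->
  w 0 = 0 -> forall t : R, 0 <= t -> w t = 0.
Proof.
move=> w0 dw w00 t; rewrite le_eqVlt => /predU1P[<-//|t0].
have dE (s : R) : is_derive s 1 (fun s : R => expR (- (c * s))) (- c * expR (- (c * s))).
  have dl : is_derive s 1 (fun s => - (c * s)) (- c).
    have -> : (fun s => - (c * s)) = - c \*: id.
      by apply/funext => s' /=; rewrite -mulNr.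
    by apply: is_derive_eq; rewrite /GRing.scale/= mulr1.
  have := @is_derive1_comp _ (@expR R) _ _ _ _ (is_derive_expR _) dl.
  by rewrite mulrC.
pose E := (fun s : R => expR (- (c * s))) * w.
have dEw (s : R) : 0 < s -> is_derive s 1 E 0.
  move=> s0; have dws := dw s s0; apply: is_derive_eq.
  rewrite /GRing.scale/=; ring.
have cE (s : R) : 0 < s -> {for s, continuous E}.
  by move=> s0; exact: is_derive_continuous (dEw s s0).
have [||u _] := @MVT _ E (fun=> 0) 0 t t0.
- by move=> s; rewrite in_itv/= => /andP[s0 _]; exact: dEw.
- apply/continuous_within_itvP => //; split.
  + by move=> s; rewrite in_itv/= => /andP[s0 _]; exact: cE.
  + apply: cvgM => //; apply: cvg_at_right_filter.
    exact: is_derive_continuous (dE 0).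
  + by apply: cvg_at_left_filter; exact: cE.
rewrite mul0r /E !fctE w00 mulr0 subr0 => /eqP.
by rewrite mulf_eq0 gt_eqF ?expR_gt0//= => /eqP.
Qed.

(** The system is triangular: once the components below [k] agree, the
    difference of the [k]-th ones solves [w' = a 0 * w]. *)
Lemma conv_ode_unique (R : realType) (u v : nat -> R -> R) (a : nat -> R) :
  (forall k, u k t @[t --> (0 : R)^'+] --> u k 0) ->
  (forall k, v k t @[t --> (0 : R)^'+] --> v k 0) ->
  (forall k, u k 0 = v k 0) ->
  (forall k (t : R), 0 < t -> is_derive t 1 (u k) (conv (u ^~ t) a k)) ->
  (forall k (t : R), 0 < t -> is_derive t 1 (v k) (conv (v ^~ t) a k)) ->
  forall k (t : R), 0 <= t -> u k t = v k t.
Proof.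
move=> cu cv uv0 du dv; elim/ltn_ind => k IH t t0; apply/eqP; rewrite -subr_eq0.
apply/eqP; apply: (@linear_ode_unique R (u k - v k) (a 0%N)) t t0.
- exact: cvgB.
- move=> t t0; have dut := du k t t0; have dvt := dv k t t0.
  apply: is_derive_eq; rewrite /conv !big_ord_recr/= subnn.
  under eq_bigr => j _ do rewrite (IH j (ltn_ord j) t (ltW t0)).
  by rewrite opprD addrACA subrr add0r -mulrBl mulrC.
- by rewrite !fctE uv0 subrr.
Qed.

(** * The law of the counting process *)

Lemma littleo_quotient (R : realType) (f g : R -> R) (b c : R) :
  f = g +o_ (0^'+) (fun h : R => h) -> (forall h, g h = b + h * c) ->
  h^-1 * (f h - b) @[h --> 0^'+] --> c.
Proof.
move=> /eqaddoP fg gE; apply/cvgrPdist_le => e e0; near=> h.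
have h0 : 0 < h by near: h; exact: nbhs_right_gt.
have fgh : `|f h - g h| <= e * `|h| by near: h; exact: fg.
have -> : c - h^-1 * (f h - b) = - (h^-1 * (f h - g h)).
  by rewrite gE; field; rewrite gt_eqF.
rewrite normrN normrM gtr0_norm ?invr_gt0// ler_pdivrMl//.
by rewrite [h * e]mulrC -[X in _ <= e * X](gtr0_norm h0).
Unshelve. all: by end_near. Qed.

Definition counting_pmf (d : measure_display) (T : measurableType d)
    (R : realType) (P : probability T R) (N : R -> T -> nat)
    (k : nat) (t : R) : R :=
  fine (P (N t @^-1` [set k])).

(** The coefficient of order [l] of [exp (- s f (x - x u))] as a power series in
    [u]. *)
Definition bernstein_taylor (R : realType)
    (nu : {measure set (measurableTypeR R) -> \bar R}) (l : nat) (s x : R) : R :=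
  (- x) ^+ l * exp_taylor_coef (bernstein_deriv nu) s l x.

(** The opposite of the coefficient of order [l] of [f (x - x u)] as a power
    series in [u]; for [l > 0] it is the rate of jumps of size [l]. *)
Definition bernstein_generator (R : realType)
    (nu : {measure set (measurableTypeR R) -> \bar R}) (x : R) (l : nat) : R :=
  - ((- x) ^+ l * taylor_coef (bernstein_deriv nu) l x).

Section bernstein_taylor.
Variables (R : realType) (nu : {measure set (measurableTypeR R) -> \bar R}).
Hypothesis hnu : levy_integrable nu.

Let dF m (x : R) : 0 < x ->
  is_derive x 1 (bernstein_deriv nu m) (bernstein_deriv nu m.+1 x).
Proof. exact: is_derive_bernstein_deriv. Qed.

Lemma derivable_exp_bernstein (l : nat) (s x : R) : 0 < x ->
  derivable (derive1n l (exp_bernstein nu s)) x 1.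
Proof. exact: (derivable_exp_taylor dF). Qed.

Lemma is_derive_bernstein_taylor (l : nat) (s x : R) : 0 < x ->
  is_derive s 1 (fun t => bernstein_taylor nu l t x)
    (conv (fun j => bernstein_taylor nu j s x) (bernstein_generator nu x) l).
Proof.
move=> x0; have := is_deriveZ ((- x) ^+ l) (is_derive_time_exp_taylor_coef dF s l x0).
congr (is_derive _ _ _ _).
rewrite /GRing.scale/= mulrN /conv mulr_sumr -sumrN; apply: eq_bigr => j _.
rewrite /bernstein_taylor /bernstein_generator mulrN; congr (- _).
by rewrite [RHS]mulrACA -exprD subnKC ?leq_ord.
Qed.

Lemma bernstein_taylor0 (l : nat) (x : R) : 0 < x ->
  bernstein_taylor nu l 0 x = (l == 0%N)%:R.
Proof.
move=> x0; rewrite /bernstein_taylor; case: l => [|l].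
  by rewrite mul1r /exp_taylor_coef fact0 divr1/= mul0r oppr0 expR0.
have [_ ] := exp_taylor_coef_rec dF 0 l x0.
rewrite oppr0 mul0r => /eqP; rewrite mulf_eq0 pnatr_eq0/= => /eqP ->.
by rewrite mulr0.
Qed.

Lemma derivative_sumE (x : R) (k : nat) :
  derivative_sum x nu k = \sum_(l < k) (fun s => bernstein_taylor nu l s x).
Proof.
apply/funext => s; rewrite fct_sumE; apply: eq_bigr => l _.
by rewrite /bernstein_taylor /exp_taylor_coef mulrAC mulrA.
Qed.

Lemma bernstein_generator0 (x : R) : bernstein_generator nu x 0 = - bernstein nu x.
Proof. by rewrite /bernstein_generator /taylor_coef mul1r fact0 divr1. Qed.

Lemma bernstein_generatorS (x : R) (k : nat) : 0 < x -> (0 < k)%N ->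
  bernstein_generator nu x k = jump_rate x nu k.
Proof.
case: k => // k x0 _; rewrite /bernstein_generator /taylor_coef /jump_rate.
have -> : \int[nu]_(s in `]0, +oo[) (expR (- (x * s)) * s ^+ k.+1) =
    (-1) ^+ k * bernstein_deriv nu k.+1 x.
  rewrite -RintegralZl//; last exact: integrable_bernstein_kernel.
  apply: eq_Rintegral => s _.
  by rewrite /= mulrA -exprD addnn -signr_odd odd_double mul1r mulrC.
rewrite [(- x) ^+ _]exprNn [(-1) ^+ k.+1]exprS.
by move: ((-1) ^+ k) (x ^+ k.+1) (k.+1)`!%:R^-1 (bernstein_deriv _ _ _) => *; ring.
Qed.

End bernstein_taylor.

Section counting_law.
Context (d : measure_display) (T : measurableType d) (R : realType)
  (P : probability T R) (lambda : R)
  (nu : {measure set (measurableTypeR R) -> \bar R}) (N : R -> T -> nat).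
Hypotheses (lambda_gt0 : 0 < lambda) (hnu : levy_integrable nu)
  (hN : generalized_poisson_process P lambda nu N).

Let p := counting_pmf P N.

Lemma measurable_level (t : R) (A : set nat) : 0 <= t -> measurable (N t @^-1` A).
Proof. by move=> t0; rewrite -[X in measurable X]setTI; exact: (gpp_measurable hN). Qed.

Let fin_P (A : set T) : measurable A -> P A \is a fin_num.
Proof. exact: fin_num_measure. Qed.

Lemma increment_start (t : R) : increment N 0 t = N t.
Proof. by apply/funext => w; rewrite /increment (gpp_start hN) subn0. Qed.

Let p_ge0 k t : 0 <= t -> 0 <= p k t.
Proof. by move=> t0; apply: fine_ge0; exact: measure_ge0. Qed.

Let p_le1 k t : 0 <= t -> p k t <= 1.
Proof.
move=> t0; have mA := measurable_level [set k] t0.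
by rewrite -lee_fin fineK ?probability_le1//; exact: fin_P.
Qed.

Let p_start k : p k 0 = (k == 0%N)%:R.
Proof.
rewrite /p /counting_pmf; case: eqP => [->|k0].
  rewrite (_ : _ @^-1` _ = setT) ?probability_setT//.
  by apply/seteqP; split => // w _ /=; exact: gpp_start hN w.
rewrite (_ : _ @^-1` _ = set0) ?measure0//.
by apply/seteqP; split => // w /=; rewrite (gpp_start hN) => /esym.
Qed.

Lemma increment_pair (s t : R) (i j : nat) : 0 <= s -> 0 <= t ->
  P ((N s @^-1` [set i]) `&` (increment N s (s + t) @^-1` [set j])) =
  (P (N s @^-1` [set i]) * P (N t @^-1` [set j]))%E.
Proof.
move=> s0 t0.
(* Times 0, s, s + t, s + t, ...: the two increments are the first two steps. *)
pose u (m : nat) := if m is m'.+1 then (if m' is _.+1 then s + t else s) else 0.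
have u0 : 0 <= u 0%N by [].
have und : nondecreasing_seq u.
  apply/nondecreasing_seqP => -[|[|m]] //=; by rewrite ?lerDl.
pose A (m : 'I_2) := if m == ord0 then [set i] else [set j].
have mA m : measurable (A m) by [].
have := gpp_independent_increments hN u0 und mA.
rewrite !big_ord_recl big_ord0 mule1 /A/= increment_start.
have -> : P (increment N s (s + t) @^-1` [set j]) = P (N t @^-1` [set j]).
  rewrite (gpp_stationary_increments hN s0 (lexx 0) t0)//.
  by rewrite add0r increment_start.
move=> <-; congr (P _); apply/seteqP; split => w /=.
  move=> [si ij] m _; rewrite /A; case: (unliftP ord0 m) => [m' ->|->] /=.
    by rewrite ord1.
  by rewrite increment_start.
move=> H; split; first by have := H ord0 I; rewrite /A/= increment_start.
by have := H (lift ord0 ord0) I.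
Qed.

Let p_semigroup k s t : 0 <= s -> 0 <= t ->
  p k (s + t) = conv (p ^~ s) (p ^~ t) k.
Proof.
move=> s0 t0; have st0 : 0 <= s + t by rewrite addr_ge0.
(* The event is split according to the value of the path at time s. *)
pose F j := (N s @^-1` [set j]) `&`
  (increment N s (s + t) @^-1` [set (k - j)%N]).
have Nle w : (N s w <= N (s + t) w)%N.
  by apply: (gpp_nondecreasing hN) => //; rewrite lerDl.
have FE : N (s + t) @^-1` [set k] = \big[setU/set0]_(j < k.+1) F j.
  rewrite -bigcup_mkord.
  apply/seteqP; split => w /=.
    move=> Nk; have sk : (N s w < k.+1)%N by rewrite ltnS -Nk.
    by exists (N s w) => //; split => //=; rewrite /increment Nk.
  move=> [j /= jk [/= Nj]]; rewrite /increment Nj => NE.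
  by rewrite -(subnK (Nle w)) Nj NE subnK.
rewrite /p /counting_pmf FE measure_bigsetU//; last 2 first.
- move=> j; apply: measurableI; first exact: measurable_level.
  rewrite (_ : _ @^-1` _ = \bigcup_m (N s @^-1` [set m] `&`
      N (s + t) @^-1` [set n | (n - m)%N = (k - j)%N])).
    by apply: bigcup_measurable => m _; apply: measurableI; exact: measurable_level.
  apply/seteqP; split => w; first by move=> /= wE; exists (N s w).
  by move=> [m _ [/= <-]].
- by move=> i j _ _ [w [[/= wi _] [/= wj _]]]; rewrite -wi.
rewrite (eq_bigr (fun j : 'I_k.+1 => (p j s * p (k - j)%N t)%:E)) ?sumEFin// => j _.
apply: etrans (increment_pair j (k - j) s0 t0) _.
by rewrite EFinM !fineK ?fin_P//; exact: measurable_level.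
Qed.

Let p_generator k :
  h^-1 * (p k h - (k == 0%N)%:R) @[h --> 0^'+] --> bernstein_generator nu lambda k.
Proof.
have E : (fun h => fine (P (increment N 0 (0 + h) @^-1` [set k]))) = p k.
  by apply/funext => h; rewrite add0r increment_start.
case: k E => [|k] E.
  have := gpp_no_jump hN (lexx 0); rewrite E => /littleo_quotient; apply => h.
  by rewrite bernstein_generator0 mulrN.
have := gpp_jump hN (lexx 0) (ltn0Sn k); rewrite E => /littleo_quotient; apply => h.
by rewrite bernstein_generatorS// add0r.
Qed.

(** Both families solve the differential system attached to
    [bernstein_generator] and start from the unit mass at [0]. *)
Lemma counting_pmfE (k : nat) (t : R) : 0 <= t ->
  counting_pmf P N k t = bernstein_taylor nu k t lambda.
Proof.
apply: (@conv_ode_unique _ p (fun l s => bernstein_taylor nu l s lambda)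
          (bernstein_generator nu lambda)) => {k t}.
- by move=> k; rewrite p_start; exact: (semigroup_cvg0 p_generator).
- move=> k; apply: cvg_at_right_filter.
  exact: (is_derive_continuous (is_derive_bernstein_taylor hnu k 0 lambda_gt0)).
- by move=> k; rewrite p_start bernstein_taylor0.
- move=> k t t0; exact: (semigroup_is_derive p_ge0 p_le1 p_semigroup p_generator).
- by move=> k t t0; exact: is_derive_bernstein_taylor.
Qed.

End counting_law.

(** * Densities from distribution functions *)

Section density_measure.
Context (R : realType) (h : R -> R).
Hypotheses (mh : measurable_fun [set: measurableTypeR R] h)
  (h_ge0 : forall x, 0 <= h x).

Definition density_measure (A : set (measurableTypeR R)) : \bar R :=
  (\int[lebesgue_measure]_(x in A) (h x)%:E)%E.

Let density_measure0 : density_measure set0 = 0%E.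
Proof. by rewrite /density_measure integral_set0. Qed.

Let density_measure_ge0 A : (0 <= density_measure A)%E.
Proof. by apply: integral_ge0 => x _; rewrite lee_fin. Qed.

Let density_measure_sigma_additive : semi_sigma_additive density_measure.
Proof.
move=> A mA tA mUA; rewrite /density_measure; apply: cvg_toP.
  apply: ereal_nondecreasing_is_cvgn => m n mn.
  apply: lee_sum_nneg_natr => // k _ _.
  by apply: integral_ge0 => x _; rewrite lee_fin.
rewrite ge0_integral_bigcup//=.
  by apply: measurable_funTS; exact/measurable_EFinP.
by move=> x _; rewrite lee_fin.
Qed.

HB.instance Definition _ := isMeasure.Build _ _ _ density_measure
  density_measure0 density_measure_ge0 density_measure_sigma_additive.

(** Packages the measure with the two hypotheses on which the instance depends,
    which could not be inferred from [h] alone. *)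
Definition density_measure_of : {measure set (measurableTypeR R) -> \bar R} :=
  density_measure.

End density_measure.

(** The law of [X] restricted to [(0, oo)] and the measure of density [g] agree on
    the intervals [(a, b]], where both are increments of [F], by the fundamental
    theorem of calculus. *)
Lemma has_density_of_cdf (d : measure_display) (T : measurableType d)
    (R : realType) (P : probability T R) (X : T -> \bar R) (F g : R -> R) :
  measurable_fun [set: T] X ->
  (forall t, 0 <= t -> P (X @^-1` [set y | (y <= t%:E)%E]) = (F t)%:E) ->
  (forall t : R, is_derive t 1 F (g t)) -> continuous g ->
  has_density_on P X `]0, +oo[ g.
Proof.
move=> mX FE dF cg.
have mle t : measurable (X @^-1` [set y | (y <= t%:E)%E]).
  rewrite -[X in measurable X]setTI; apply: mX => //.
  by rewrite -set_itvNyc; exact: emeasurable_itv.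
have F_le s t : 0 <= s -> s <= t -> F s <= F t.
  move=> s0 st; have t0 := le_trans s0 st.
  rewrite -lee_fin -!FE// le_measure ?inE//.
  by move=> w /= /le_trans; apply; rewrite lee_fin.
have g_ge0 s : 0 < s -> 0 <= g s.
  move=> s0; have /@derive_val <- := dF s; apply: limr_ge.
    by have /@ex_derive := dF s.
  near=> h.
  have h_s : `|h| <= s by near: h; apply: dnbhs0_le.
  rewrite /= [_ *: 1]mulr1 /GRing.scale/=.
  have sh0 : 0 <= h + s by move: h_s; rewrite ler_norml => /andP[]; lra.
  have [h0|h0] := leP 0 h.
    by rewrite mulr_ge0 ?invr_ge0// subr_ge0 F_le ?(ltW s0)//; lra.
  by rewrite mulr_le0 ?invr_le0 ?(ltW h0)// subr_le0 F_le//; lra.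
have mg : measurable_fun [set: measurableTypeR R] g.
  exact: continuous_measurable_fun.
split=> //; first exact: measurable_funTS.
  by move=> s /=; rewrite in_itv/= andbT => /g_ge0.
have mD : measurable (`]0, +oo[ : set (measurableTypeR R)) by [].
(* [fine] sends the infinite values to 0, which lies outside (0, oo), so the real
   random variable [fine \o X] has the same law as [X] there. *)
have mY : measurable_fun [set: T] (fine \o X : T -> measurableTypeR R).
  exact: measurableT_comp.
pose Y : {mfun T >-> measurableTypeR R} :=
  HB.pack (fine \o X) (isMeasurableFun.Build _ _ _ _ _ mY).
(* The absolute value makes the density nonnegative everywhere without changing
   it on (0, oo). *)
have mag : measurable_fun [set: measurableTypeR R] (fun x => `|g x|).
  exact: measurableT_comp.
pose m1 : {measure set (measurableTypeR R) -> \bar R} := mrestr (distribution P Y) mD.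
pose m2 : {measure set (measurableTypeR R) -> \bar R} :=
  mrestr (density_measure_of mag (fun x => normr_ge0 (g x))) mD.
have m12 B : ocitv B -> m1 B = m2 B.
  move=> [[a b] _ /= <-]; rewrite /m1 /m2 /mrestr/=.
  have -> : `]a, b] `&` `]0, +oo[ = `]Num.max a 0, b]%classic :> set R.
    apply/seteqP; split => x /=; rewrite !in_itv/= gt_max andbT.
      by move=> [/andP[-> ->] ->].
    by move=> /andP[/andP[-> ->] ->].
  have : 0 <= Num.max a 0 by rewrite le_max lexx orbT.
  move: (Num.max a 0) => {}a a0; have [ba|ab] := leP b a.
    by rewrite set_itv_ge ?measure0//= bnd_simp -leNgt.
  have b0 : 0 <= b by exact: le_trans (ltW ab).
  rewrite /density_measure_of /density_measure/= /distribution /pushforward/=.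
  have -> : (fine \o X) @^-1` `]a, b]%classic = X @^-1` [set y | (y <= b%:E)%E] `\`
      X @^-1` [set y | (y <= a%:E)%E].
    apply/seteqP; split => w /=; rewrite in_itv/=; case: (X w) => [r| |] /=.
    - by rewrite !lee_fin => /andP[ar ->]; split => //; apply/negP; rewrite -ltNge.
    - by rewrite ltNge a0.
    - by rewrite ltNge a0.
    - by rewrite !lee_fin => -[-> /negP]; rewrite -ltNge => ->.
    - by rewrite leye_eq => -[].
    - by move=> [_]; rewrite leNye.
  transitivity ((F b)%:E - (F a)%:E)%E.
    rewrite -!FE// measureD//; last by rewrite ltey_eq fin_num_measure.
    congr (_ - P _)%E; apply: setIidr => w /= /le_trans; apply.
    by rewrite lee_fin ltW.
  transitivity (\int[lebesgue_measure]_(x in `[a, b]) (g x)%:E)%E.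
    rewrite (@continuous_FTC2 _ _ F)//.
    - by apply: continuous_subspaceT.
    - split; first by move=> x _; have /@ex_derive := dF x.
      + by apply: cvg_at_right_filter; exact: is_derive_continuous (dF a).
      + by apply: cvg_at_left_filter; exact: is_derive_continuous (dF b).
    - by move=> x _; rewrite derive1E; have /@derive_val := dF x.
  rewrite -integral_itv_obnd_cbnd//; last exact/measurable_EFinP/measurable_funTS.
  apply: eq_integral => x; rewrite inE/= in_itv/= => /andP[ax _].
  by rewrite ger0_norm// g_ge0// (le_lt_trans a0).
move=> A mA AD.
pose B (n : nat) : set (measurableTypeR R) := `](- n%:R), n%:R]%classic.
have cover : \bigcup_n B n = [set: R].
  rewrite -subTset => x _; exists (Num.truncn `|x|).+1 => //=.
  have := truncnS_gt `|x|; by rewrite ltr_norml /B/= in_itv/= => /andP[-> /ltW ->].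
have m1_fin n : (m1 (B n) < +oo)%E.
  have mB : measurable (B n) by exact: measurable_itv.
  have mYB : measurable (Y @^-1` (B n `&` `]0, +oo[)).
    by rewrite -[X in measurable X]setTI; exact: (mY _ _ (measurableI _ _ mB mD)).
  exact: le_lt_trans (probability_le1 P mYB) (ltry 1).
have : m1 A = m2 A.
  have oB n : ocitv (B n) by exact: is_ocitv.
  exact: (@measure_unique _ _ (measurableTypeR R) (@ocitv R) B erefl (@ocitvI R)
    oB cover m1 m2 m12 m1_fin A mA).
rewrite -[m1 A]/(distribution P Y (A `&` _)) -[m2 A]/(density_measure _ (A `&` _)).
rewrite (setIidl AD) => m1A.
transitivity (distribution P Y A).
  congr (P _); apply/seteqP; split => w /=; last first.
    case: (X w) => [r Ar|/AD|/AD] /=; [by exists r|by rewrite in_itv/= ltxx..].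
  by move=> [r Ar <-].
rewrite m1A; apply: eq_integral => x /set_mem/AD /=; rewrite in_itv/= andbT => x0.
by rewrite ger0_norm// g_ge0.
Unshelve. all: by end_near. Qed.

(** * The passage time *)
Section passage_time.
Context (d : measure_display) (T : measurableType d) (R : realType)
  (P : probability T R) (lambda : R)
  (nu : {measure set (measurableTypeR R) -> \bar R}) (N : R -> T -> nat).
Hypothesis hN : generalized_poisson_process P lambda nu N.

(** If [N t < k] then, the path being integer-valued, right continuity makes it
    constant on some [[t, t + e)], so that the infimum exceeds [t]. *)
Lemma passage_time_le (k : nat) (t : R) (w : T) : 0 <= t ->
  (passage_time N k w <= t%:E)%E = (k <= N t w)%N.
Proof.
move=> t0; apply/idP/idP => [|kN]; last by apply: ereal_inf_lbound; exists t.
apply: contraTT; rewrite -ltnNge -ltNge => Nk.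
have [e /= e0 He] : \forall u \near t^'+, N u w = N t w.
  have := gpp_right_continuous hN (w := w) t0.
  move=> /cvgrPdist_lt /(_ 1 ltr01); apply: filterS => u.
  case: (ltngtP (N u w) (N t w)) => // Nu.
  - rewrite -natrB ?(ltnW Nu)// ger0_norm// ltrn1 ltnS leqn0 subn_eq0 leqNgt Nu//.
  - rewrite distrC -natrB ?(ltnW Nu)// ger0_norm// ltrn1 ltnS leqn0 subn_eq0 leqNgt Nu//.
have te : (t%:E < (t + e / 2)%:E)%E by rewrite lte_fin ltrDl divr_gt0.
apply: (lt_le_trans te); apply: le_ereal_inf_tmp => _ [u [u0 kN] <-].
rewrite lee_fin leNgt; apply/negP => ut.
have Nte : N (t + e / 2) w = N t w.
  apply: He => /=; last by rewrite ltrDl divr_gt0.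
  rewrite opprD addNKr normrN gtr0_norm ?divr_gt0//; lra.
have := gpp_nondecreasing hN w u0 (ltW ut).
by rewrite Nte leqNgt (leq_trans Nk kN).
Qed.

Lemma measurable_passage_time (k : nat) :
  measurable_fun [set: T] (passage_time N k).
Proof.
apply: (measurability _ (ErealGenOInfty.measurableE R)) => //.
move=> _ [_ [r ->] <-]; rewrite setTI.
have -> : passage_time N k @^-1` `]r%:E, +oo[%classic =
    if 0 <= r then N r @^-1` [set n | (n < k)%N] else setT.
  apply/seteqP; split => w /=; rewrite in_itv/= andbT.
    by case: ifPn => // r0; rewrite ltNge passage_time_le// -ltnNge.
  case: ifPn => [r0|]; first by rewrite /= ltnNge -passage_time_le// -ltNge.
  rewrite -ltNge => r0 _; apply: (@lt_le_trans _ _ 0%E); first by rewrite lte_fin.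
  by apply: le_ereal_inf_tmp => _ [u [u0 _] <-]; rewrite lee_fin.
by case: ifPn => // r0; exact: (measurable_level hN _ r0).
Qed.

End passage_time.

Lemma counting_cdf (d : measure_display) (T : measurableType d)
    (R : realType) (P : probability T R) (lambda : R)
    (nu : {measure set (measurableTypeR R) -> \bar R})
    (N : R -> T -> nat) (k : nat) (t : R) :
  0 < lambda -> levy_integrable nu ->
  generalized_poisson_process P lambda nu N -> 0 <= t ->
  P (N t @^-1` [set n | (k <= n)%N]) = (1 - derivative_sum lambda nu k t)%:E.
Proof.
move=> lambda0 hnu hN t0.
have mN (A : set nat) : measurable (N t @^-1` A).
  exact: (measurable_level hN A t0).
have -> : N t @^-1` [set n | (k <= n)%N] =
    ~` \big[setU/set0]_(l < k) (N t @^-1` [set (l : nat)]).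
  rewrite -(bigcup_mkord k (fun l => N t @^-1` [set l])).
  apply/seteqP; split => w /=.
    by move=> kN [l /= lk Nl]; rewrite Nl leqNgt lk in kN.
  by move=> H; rewrite leqNgt; apply/negP => Nk; apply: H; exists (N t w).
rewrite probability_setC; last by apply: bigsetU_measurable => l _.
rewrite [RHS]EFinB; congr (_ - _)%E.
rewrite (measure_bigsetU P (fun l => mN [set l])); last first.
  by move=> i j _ _ [w [/= <- <-]].
rewrite derivative_sumE fct_sumE -sumEFin; apply: eq_bigr => l _.
by rewrite -(counting_pmfE lambda0 hnu hN)// fineK// fin_num_measure.
Qed.

(* [derive1] and [derive1n] are total, so the existence of the derivatives
   occurring in the formula is asserted separately; continuity of the density
   makes its value meaningful at every point [s > 0]. *)
Theorem mainTheorem6 (d : measure_display) (T : measurableType d)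
    (R : realType) (P : probability T R) (lambda : R)
    (nu : {measure set (measurableTypeR R) -> \bar R})
    (N : R -> T -> nat) (k : nat) :
  0 < lambda ->
  levy_integrable nu ->
  generalized_poisson_process P lambda nu N ->
  (1 <= k)%N ->
  [/\ forall (l : nat) (s x : R), (l.+1 < k)%N -> 0 < s -> 0 < x ->
        derivable (derive1n l (exp_bernstein nu s)) x 1,
      forall s : R, 0 < s -> derivable (derivative_sum lambda nu k) s 1,
      {in `]0, +oo[, continuous (fun s => - derive1 (derivative_sum lambda nu k) s)} &
      has_density_on P (passage_time N k) `]0, +oo[
        (fun s => - derive1 (derivative_sum lambda nu k) s)].
Proof.
move=> lambda0 hnu hN _.
set S := derivative_sum lambda nu k.
pose q l s := bernstein_taylor nu l s lambda.
pose S' s := \sum_(l < k) conv (q ^~ s) (bernstein_generator nu lambda) l.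
have dq l (s : R) : is_derive s 1 (q l) (conv (q ^~ s) (bernstein_generator nu lambda) l).
  exact: is_derive_bernstein_taylor.
have dS (s : R) : is_derive s 1 S (S' s).
  by rewrite /S derivative_sumE; apply: is_derive_sum => l; exact: dq.
have gE : (fun s => - derive1 S s) = (fun s => - S' s).
  by apply/funext => s; rewrite derive1E; have /@derive_val -> := dS s.
have cg : continuous (fun s => - S' s).
  move=> s; apply: cvgN; apply: (cvg_big (@add_continuous _)) => l _.
  by apply: cvg_conv => j _; [exact: is_derive_continuous (dq j s)|exact: cvg_cst].
rewrite gE; split.
- by move=> l s x _ _ x0; exact: derivable_exp_bernstein.
- by move=> s _; have /@ex_derive := dS s.
- by move=> s _; exact: cg.
apply: (@has_density_of_cdf _ _ _ _ _ (fun t => 1 - S t)) => //.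
- exact: measurable_passage_time hN k.
- move=> t t0; rewrite -(counting_cdf _ _ _ hN)//; congr (P _).
  by apply/seteqP; split => w /=; rewrite (passage_time_le hN).
- move=> t; have := is_deriveB (is_derive_cst (1 : R) t 1) (dS t).
  by rewrite sub0r.
Qed.
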